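(* Let $X$ and $Y$ be complex Banach spaces, not both zero, and let $1\le p<\infty$. Then $$\mathrm{Ext}_{\mathbb{C}}(\overline{B}_{X\oplus_pY})=\{x+y\in S_{X\oplus_pY}:\ x\in\mathrm{Ext}_{\mathbb{C}}(\|x\|\overline{B}_X)\ \text{ and }\ y\in\mathrm{Ext}_{\mathbb{C}}(\|y\|\overline{B}_Y)\}.$$
   Context: $X\oplus_pY$ is the direct sum of $X$ and $Y$, whose elements are written $x+y$ with $x\in X$, $y\in Y$, with the norm $\|x+y\|=(\|x\|^p+\|y\|^p)^{1/p}$. For a Banach space $Z$, $\overline{B}_Z$ and $S_Z$ denote its closed unit ball and unit sphere, and $r\overline{B}_Z=\{rz:z\in\overline{B}_Z\}$ for $r\ge0$ (so $0\,\overline{B}_Z=\{0\}$). For a convex set $C$ in a complex Banach space $Z$, $z\in C$ is a complex extreme point of $C$ (written $z\in\mathrm{Ext}_{\mathbb{C}}(C)$) if, for $y\in Z$, having $z+\lambda y\in C$ for all $\lambda\in\mathbb{C}$ with $|\lambda|\le1$ implies $y=0$. *)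

(* Defs.v *)
From HB Require Import structures.
From mathcomp Require Import all_boot all_order all_algebra.
From mathcomp Require Import complex.
From mathcomp Require Import all_classical all_reals all_analysis.
From mathcomp Require Import ring.

Set Implicit Arguments.
Unset Strict Implicit.
Unset Printing Implicit Defensive.

Import Order.TTheory GRing.Theory Num.Theory.
Import numFieldNormedType.Exports.

Local Open Scope classical_set_scope.
Local Open Scope complex_scope.
Local Open Scope ring_scope.

(* A complex Banach space is a [completeNormedModType R[i]] with
   [R : realType].  Its norm takes values in [R[i]], and these values are
   nonnegative reals because [0 <= z] in [R[i]] forces [Im z = 0]. *)

Definition closed_unit_ball (K : numFieldType) (Z : normedModType K) : set Z :=
  [set z | `|z| <= 1].
Arguments closed_unit_ball {K} Z _ /.

Definition unit_sphere (K : numFieldType) (Z : normedModType K) : set Z :=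
  [set z | `|z| = 1].
Arguments unit_sphere {K} Z _ /.

Definition scale_set (K : numFieldType) (Z : lmodType K) (r : K) (A : set Z) :
  set Z := [set r *: z | z in A].

Definition complex_extreme (R : realType) (Z : lmodType R[i]) (C : set Z) :
  set Z :=
  [set z | C z /\
    forall y : Z, (forall l : R[i], `|l| <= 1 -> C (z + l *: y)) -> y = 0].

Section two_point_minkowski.
Context {R : realType}.
Implicit Types p a b c d A B : R.

Lemma powR2_ge0 p a b : 0 <= a `^ p + b `^ p.
Proof. by rewrite addr_ge0 ?powR_ge0. Qed.

Lemma powR_powRV p a : 1 <= p -> 0 <= a -> (a `^ p) `^ p^-1 = a.
Proof.
move=> p1 a0; have p0 : p != 0 by rewrite gt_eqF// (lt_le_trans ltr01).
by rewrite -powRrM mulfV// powRr1.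
Qed.

Lemma powRV_powR p a : 1 <= p -> 0 <= a -> (a `^ p^-1) `^ p = a.
Proof.
move=> p1 a0; have p0 : p != 0 by rewrite gt_eqF// (lt_le_trans ltr01).
by rewrite -powRrM mulVf// powRr1.
Qed.

Lemma convex_powR_div p a b A B : 1 <= p -> 0 <= a -> 0 <= b ->
  0 < A -> 0 < B ->
  ((a + b) / (A + B)) `^ p <=
  A / (A + B) * (a / A) `^ p + B / (A + B) * (b / B) `^ p.
Proof.
move=> p1 a0 b0 A0 B0; have AB0 : 0 < A + B by rewrite addr_gt0.
have t01 : Itv.spec (@Itv.num_sem R) (Itv.Real `[0%Z, 1%Z]) (A / (A + B)).
  apply/and3P; split; first exact: num_real.
    by rewrite bnd_simp /= divr_ge0// ltW.
  by rewrite bnd_simp /= ler_pdivrMr// mul1r lerDl ltW.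
have := @convex_powR R p p1 (Itv.mk t01) (a / A) (b / B).
rewrite !inE/= !in_itv/= !andbT !divr_ge0 ?(ltW A0) ?(ltW B0)//.
move=> /(_ isT isT) H.
rewrite [leRHS]convRE [X in X `^ _ <= _]convRE/= /unstable.onem in H; move: H.
have -> : 1 - A / (A + B) = B / (A + B).
  by rewrite -[X in X - _](divff (lt0r_neq0 AB0)) -mulrBl addrAC subrr add0r.
suff -> : A / (A + B) * (a / A) + B / (A + B) * (b / B) = (a + b) / (A + B)
  by [].
by field; rewrite !lt0r_neq0.
Qed.

Lemma minkowski2 p a b c d : 1 <= p -> 0 <= a -> 0 <= b -> 0 <= c -> 0 <= d ->
  ((a + c) `^ p + (b + d) `^ p) `^ p^-1 <=
  (a `^ p + b `^ p) `^ p^-1 + (c `^ p + d `^ p) `^ p^-1.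
Proof.
move=> p1 a0 b0 c0 d0.
have p0 : p != 0 by rewrite gt_eqF// (lt_le_trans ltr01).
have pV0 : p^-1 != 0 by rewrite invr_eq0.
move AE : ((a `^ p + b `^ p) `^ p^-1) => A.
move BE : ((c `^ p + d `^ p) `^ p^-1) => B.
have zero u v : 0 <= u -> 0 <= v -> (u `^ p + v `^ p) `^ p^-1 = 0 ->
    u = 0 /\ v = 0.
  move=> u0 v0 /powR_eq0_eq0 /eqP; rewrite paddr_eq0 ?powR_ge0// => /andP[].
  by move=> /eqP/powR_eq0_eq0 -> /eqP/powR_eq0_eq0 ->.
have [A0|A0] := eqVneq A 0.
  by move: AE; rewrite A0 => /(zero _ _ a0 b0)[-> ->]; rewrite !add0r BE.
have [B0|B0] := eqVneq B 0.
  by move: BE; rewrite B0 => /(zero _ _ c0 d0)[-> ->]; rewrite !addr0 AE.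
have {}A0 : 0 < A by rewrite lt0r A0 -AE powR_ge0.
have {}B0 : 0 < B by rewrite lt0r B0 -BE powR_ge0.
have AB0 : 0 < A + B by exact: addr_gt0.
have pge0 : 0 <= p by rewrite (le_trans ler01).
have divp u v : 0 <= u -> 0 < v -> (u / v) `^ p = u `^ p / v `^ p.
  move=> u0 /ltW v0; rewrite powRM ?invr_ge0//.
  by rewrite -(powR_inv1 v0) powRAC powR_inv1 ?powR_ge0.
have E1 : (a / A) `^ p + (b / A) `^ p = 1.
  rewrite !divp// -mulrDl -AE powRV_powR ?powR2_ge0// mulfV//.
  by apply: contraTneq A0 => E; rewrite -AE E powR0// ltxx.
have E2 : (c / B) `^ p + (d / B) `^ p = 1.
  rewrite !divp// -mulrDl -BE powRV_powR ?powR2_ge0// mulfV//.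
  by apply: contraTneq B0 => E; rewrite -BE E powR0// ltxx.
have le1 : ((a + c) / (A + B)) `^ p + ((b + d) / (A + B)) `^ p <= 1.
  apply: le_trans (lerD (convex_powR_div p1 a0 c0 A0 B0)
                        (convex_powR_div p1 b0 d0 A0 B0)) _.
  rewrite addrACA -!mulrDr E1 E2 !mulr1 -mulrDl divff//.
  exact: lt0r_neq0.
rewrite -[leRHS](powR_powRV p1) ?(ltW AB0)//.
rewrite ge0_ler_powR ?invr_ge0// ?nnegrE ?powR2_ge0 ?powR_ge0//.
move: le1; rewrite !divp ?addr_ge0// -mulrDl ler_pdivrMr ?mul1r//.
exact: powR_gt0.
Qed.

End two_point_minkowski.

(* The l^p direct sum: [x + y] is the pair [(x, y)].  The alias keeps the
   norm below from competing with the library's sup norm on [X * Y]; [p1] is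
   an argument because the formula is a norm only for [1 <= p]. *)
Definition lp_sum (R : realType) (p : R) (p1 : 1 <= p)
  (X Y : completeNormedModType R[i]) : Type := (X * Y)%type.

Section lp_sum.
Context {R : realType} {p : R} (p1 : 1 <= p).
Context {X Y : completeNormedModType R[i]}.
Local Notation Z := (lp_sum p1 X Y).

HB.instance Definition _ := GRing.Lmodule.copy Z (X * Y)%type.

Definition lp_sum_norm (z : Z) : R[i] :=
  (((complex.Re `|z.1|) `^ p + (complex.Re `|z.2|) `^ p) `^ p^-1)%:C.

Lemma RRe_norm (V : normedZmodType R[i]) (v : V) :
  (complex.Re `|v|)%:C = `|v|.
Proof. by rewrite RRe_real// normr_real. Qed.

Lemma Re_norm_ge0 (V : normedZmodType R[i]) (v : V) : 0 <= complex.Re `|v|.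
Proof. by rewrite -ler0c RRe_norm. Qed.

Lemma lp_sum_normD (x y : Z) :
  lp_sum_norm (x + y) <= lp_sum_norm x + lp_sum_norm y.
Proof.
rewrite /lp_sum_norm -rmorphD/= lecR; apply: le_trans; last first.
  by apply: minkowski2 => //; exact: Re_norm_ge0.
have pge0 : 0 <= p by rewrite (le_trans ler01).
have tri (V : normedZmodType R[i]) (u v : V) :
    complex.Re `|u + v| <= complex.Re `|u| + complex.Re `|v|.
  by rewrite -lecR rmorphD/= !RRe_norm ler_normD.
rewrite ge0_ler_powR ?invr_ge0 ?nnegrE ?powR2_ge0//.
by rewrite lerD// ge0_ler_powR ?nnegrE ?addr_ge0 ?Re_norm_ge0// tri.
Qed.

Lemma lp_sum_normZ (l : R[i]) (x : Z) :
  lp_sum_norm (l *: x) = `|l| * lp_sum_norm x.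
Proof.
have N (V : normedModType R[i]) (v : V) :
    complex.Re `|l *: v| = complex.Re `|l| * complex.Re `|v|.
  by apply: complexI; rewrite rmorphM/= !RRe_norm normrZ.
rewrite /lp_sum_norm -(RRe_norm l) -rmorphM; congr (_%:C).
rewrite !N !powRM ?Re_norm_ge0// -mulrDr powRM ?powR_ge0 ?powR2_ge0//.
by rewrite powR_powRV// Re_norm_ge0.
Qed.

Lemma lp_sum_norm_eq0 (x : Z) : lp_sum_norm x = 0 -> x = 0.
Proof.
move=> /complexI /powR_eq0_eq0 /eqP.
rewrite paddr_eq0 ?powR_ge0// => /andP[/eqP/powR_eq0_eq0 x1 /eqP/powR_eq0_eq0].
move=> x2; case: x x1 x2 => x y /= x1 x2; congr pair; apply/normr0_eq0.
  by rewrite -RRe_norm x1.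
by rewrite -RRe_norm x2.
Qed.

HB.instance Definition _ :=
  Lmodule_isNormed.Build R[i] Z lp_sum_normD lp_sum_normZ lp_sum_norm_eq0.

Lemma lp_sum_normE (z : Z) : `|z| =
  (((complex.Re `|z.1|) `^ p + (complex.Re `|z.2|) `^ p) `^ p^-1)%:C.
Proof. by []. Qed.

Lemma lp_sum_fst_le (z : Z) : `|z.1| <= `|z|.
Proof.
rewrite lp_sum_normE -RRe_norm lecR -[leLHS](powR_powRV p1) ?Re_norm_ge0//.
rewrite ge0_ler_powR ?nnegrE ?powR2_ge0 ?powR_ge0 ?lerDl ?powR_ge0//.
by rewrite invr_ge0 (le_trans ler01).
Qed.

Lemma lp_sum_snd_le (z : Z) : `|z.2| <= `|z|.
Proof.
rewrite lp_sum_normE -RRe_norm lecR -[leLHS](powR_powRV p1) ?Re_norm_ge0//.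
rewrite ge0_ler_powR ?nnegrE ?powR2_ge0 ?powR_ge0 ?lerDr ?powR_ge0//.
by rewrite invr_ge0 (le_trans ler01).
Qed.

Lemma lp_sum_le (z : Z) : `|z| <= `|z.1| + `|z.2|.
Proof.
rewrite lp_sum_normE -(RRe_norm z.1) -(RRe_norm z.2) -rmorphD/= lecR.
have p0 : p != 0 by rewrite gt_eqF// (lt_le_trans ltr01).
have := @minkowski2 R p (complex.Re `|z.1|) 0 0 (complex.Re `|z.2|) p1
  (Re_norm_ge0 _) (lexx _) (lexx _) (Re_norm_ge0 _).
by rewrite !addr0 !add0r !powR0// !addr0 !add0r !powR_powRV ?Re_norm_ge0.
Qed.

Lemma lp_sum_complete (F : set_system Z) :
  ProperFilter F -> cauchy F -> cvg F.
Proof.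
move=> FF /cauchy_ballP Fc.
have cvX : cvg ((fst : Z -> X) @ F).
  apply: cauchy_cvg; apply/cauchy_ballP => e e0; rewrite near_map2.
  apply: filterS (Fc e e0) => -[x y]; rewrite -!ball_normE/=.
  exact: le_lt_trans (lp_sum_fst_le (x - y)).
have cvY : cvg ((snd : Z -> Y) @ F).
  apply: cauchy_cvg; apply/cauchy_ballP => e e0; rewrite near_map2.
  apply: filterS (Fc e e0) => -[x y]; rewrite -!ball_normE/=.
  exact: le_lt_trans (lp_sum_snd_le (x - y)).
move: cvX cvY => /cvg_ex[x Fx] /cvg_ex[y Fy].
apply/cvg_ex; exists ((x, y) : Z).
apply/cvgrPdist_lt => e e0.
have e20 : 0 < e / 2 by rewrite divr_gt0.
move/cvgrPdist_lt: Fx => /(_ _ e20) Fx; move/cvgrPdist_lt: Fy => /(_ _ e20) Fy.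
apply: filterS2 Fx Fy => z zx zy; rewrite (le_lt_trans (lp_sum_le _))//.
by rewrite [ltRHS]splitr ltrD.
Qed.

HB.instance Definition _ := Uniform_isComplete.Build Z lp_sum_complete.

End lp_sum.

(* Main.v *)
Require Import Defs.
From mathcomp Require Import all_boot all_order all_algebra.
From mathcomp Require Import complex.
From mathcomp Require Import all_classical all_reals all_analysis.
From mathcomp Require Import ring lra.
Import Order.TTheory GRing.Theory Num.Theory.
Import numFieldNormedType.Exports.
Local Open Scope classical_set_scope.
Local Open Scope complex_scope.
Local Open Scope ring_scope.

(** An extreme point of the ball has norm one, since a point of smaller norm
can be moved a little in any direction; and a perturbation of one coordinate
that does not increase its norm does not increase the norm of the pair.  This
gives one inclusion.

For the other one, let [(x, y)] be on the sphere, with [x] and [y] extreme in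
the balls of radius [|x|] and [|y|], and let [(x + l u, y + l v)] stay in the
unit ball for [|l| <= 1].  By the triangle inequality and the convexity of
[t ^ p], the sum of the [p]-th powers of the norms, averaged over [l] and [-l],
is at least its value at [0], in each coordinate separately; it is at most this
value in total.  Hence both coordinates have equality, which
forces [|x + l u| + |x - l u| = 2 |x|] for every [l] in the disk
([powR_mean_balanced]).

If [p > 1], strict convexity would even give [|x + l u| = |x|].  For [p = 1] it
does not, and the complex structure has to be used: [log |x + l u|] is
subharmonic, while the logarithm of a function [|x| + a l] with [a] real linear
is strictly superharmonic unless [a = 0].  [balanced_rnorm_eq] is a discrete
form of this argument: means are taken over the fourth roots of unity instead of
circles, and multiplication by a suitable polynomial of degree one does the work
of the logarithm.  It applies to every [p >= 1], gives [|x + l u| = |x|] for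
small [l], and so [u = 0] by extremality of [x] ([extreme_ball_balanced]);
symmetrically [v = 0]. *)

(** Norms on a space over [R[i]] are complex numbers; their real parts can be
fed to real powers and to the decision procedures for ordered fields. *)
Local Notation rnorm v := (complex.Re `|v|).

Lemma scale_closed_unit_ball (K : numFieldType) (Z : normedModType K) (r : K) :
  0 <= r -> scale_set r (closed_unit_ball Z) = [set z | `|z| <= r].
Proof.
move=> r0; apply/seteqP; split => [_ [z /= z1 <-]|z /= zr].
  by rewrite /= normrZ ger0_norm// ler_piMr.
have [r_eq0|rN0] := eqVneq r 0.
  exists 0 => /=; first by rewrite normr0.
  by move: zr; rewrite r_eq0 normr_le0 => /eqP ->; rewrite scaler0.
exists (r^-1 *: z) => /=; last by rewrite scalerA divff// scale1r.
by rewrite normrZ normfV ger0_norm// ler_pdivrMl ?mulr1// lt0r rN0.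
Qed.

(** Equality case of two simultaneous Jensen inequalities.  The bounds on the
two sums of powers add up to the reverse of the sum of
[2 m ^ p <= c ^ p + d ^ p] and [2 m' ^ p <= c' ^ p + d' ^ p], so both of these
are equalities; the first one says that the mean of [c] and [d] has a [p]-th
power at most [m ^ p]. *)
Lemma powR_mean_balanced {R : realType} (p m c d m' c' d' : R) : 1 <= p ->
  0 <= m -> 0 <= c -> 0 <= d -> 0 <= m' -> 0 <= c' -> 0 <= d' ->
  m *+ 2 <= c + d -> m' *+ 2 <= c' + d' ->
  c `^ p + c' `^ p <= m `^ p + m' `^ p ->
  d `^ p + d' `^ p <= m `^ p + m' `^ p ->
  c + d = m *+ 2.
Proof.
move=> p1 m0 c0 d0 m'0 c'0 d'0 mcd mcd' lec led.
have p0 : 0 < p by rewrite (lt_le_trans ltr01).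
have jensen a b : 0 <= a -> 0 <= b ->
    ((a + b) / 2) `^ p *+ 2 <= a `^ p + b `^ p.
  move=> a0 b0; have := convex_powR_div p1 a0 b0 (@ltr01 R) (@ltr01 R).
  by rewrite !divr1 -[1 + 1]/(2%:R); lra.
have J := jensen _ _ c0 d0.
have : m' `^ p <= ((c' + d') / 2) `^ p.
  by rewrite ge0_ler_powR ?nnegrE ?(ltW p0)//; lra.
have J' := jensen _ _ c'0 d'0 => mJ'.
apply/eqP; rewrite eq_le mcd andbT leNgt; apply/negP => cd.
have : m `^ p < ((c + d) / 2) `^ p by rewrite gt0_ltr_powR ?nnegrE//; lra.
lra.
Qed.

Lemma sqr_rnorm {R : realType} (x y : R) :
  rnorm (x +i* y) ^+ 2 = x ^+ 2 + y ^+ 2.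
Proof. by rewrite normc_def /= sqr_sqrtr// addr_ge0 ?sqr_ge0. Qed.

Section balanced.
Context {R : realType} {Z : normedModType R[i]}.
Implicit Types x u : Z.

Lemma rnormD x u : rnorm (x + u) <= rnorm x + rnorm u.
Proof. by rewrite -lecR rmorphD/= !RRe_norm ler_normD. Qed.

Lemma rnormZ (l : R[i]) x : rnorm (l *: x) = rnorm l * rnorm x.
Proof. by apply: complexI; rewrite rmorphM/= !RRe_norm normrZ. Qed.

Lemma rnorm_midpoint x u : rnorm x *+ 2 <= rnorm (x + u) + rnorm (x - u).
Proof.
apply: le_trans (rnormD _ _); rewrite addrACA subrr addr0 -mulr2n.
by rewrite normrMn raddfMn.
Qed.

(** With [m = |x|], [a = |x + u| - m], [b = |x + i u| - m] and [s = a - i b],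
the polynomial [F t = (m - t s) (x + t u)] has degree two, so its values at the
four fourth roots of unity add up to [4 F 0 = 4 m x].  Since the norms of
[x + t u] at these points are [m + a], [m + b], [m - a], [m - b], comparing
[(4 m ^ 2) ^ 2] with four times the sum of the squares of the norms of these
values gives [N m ^ 2 <= N ^ 2] for [N = a ^ 2 + b ^ 2].  As [|a|] and [|b|]
are at most [|u|], the bound on [u] leaves only [N = 0]. *)
Lemma balanced_rnorm_eq x u : rnorm u < rnorm x / 2 ->
  rnorm (x + u) + rnorm (x - u) = rnorm x *+ 2 ->
  rnorm (x + 'i%C *: u) + rnorm (x - 'i%C *: u) = rnorm x *+ 2 ->
  rnorm (x + u) = rnorm x.
Proof.
set m := rnorm x => small bal ibal.
have i1 : rnorm ('i%C : R[i]) = 1 by rewrite normc_def /= expr0n expr1n add0r sqrtr1.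
have near v : rnorm v <= rnorm u -> m - rnorm u <= rnorm (x + v) <= m + rnorm u.
  move=> vu; have := rnormD x v; have := rnormD (x + v) (- v).
  by rewrite addrK normrN -/m; lra.
have := near u (lexx _); have := near ('i%C *: u).
rewrite rnormZ i1 mul1r => /(_ (lexx _)).
pose a := rnorm (x + u) - m; pose b := rnorm (x + 'i%C *: u) - m.
have fa : rnorm (x + u) = m + a by rewrite /a; ring.
have fb : rnorm (x + 'i%C *: u) = m + b by rewrite /b; ring.
have fa' : rnorm (x - u) = m - a by rewrite /a; lra.
have fb' : rnorm (x - 'i%C *: u) = m - b by rewrite /b; lra.
rewrite fa fb => /andP[b1 b2] /andP[a1 a2].
(* These are [m - s t] at [t = 1, i, -1, -i]. *)
pose w0 := (m - a) +i* b; pose w1 := (m - b) +i* (- a).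
pose w2 := (m + a) +i* (- b); pose w3 := (m + b) +i* a.
have wE : (m *+ 4)%:C *: x = (w0 *: (x + u) + w2 *: (x - u)) +
    (w1 *: (x + 'i%C *: u) + w3 *: (x - 'i%C *: u)).
  have -> : (m *+ 4)%:C = w0 + w2 + (w1 + w3).
    by apply/eqP; rewrite eq_complex /=; apply/andP; split; apply/eqP; ring.
  have w_bal : w0 - w2 + (w1 - w3) * 'i%C = 0.
    by apply/eqP; rewrite eq_complex /=; apply/andP; split; apply/eqP; ring.
  have antipodal (k l : R[i]) v :
      k *: (x + v) + l *: (x - v) = (k + l) *: x + (k - l) *: v.
    by rewrite scalerDr scalerBr addrACA -scalerDl -scalerBl.
  by rewrite !antipodal scalerA [RHS]addrACA -!scalerDl w_bal scale0r addr0.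
have : m *+ 4 * m <= (rnorm w0 * (m + a) + rnorm w2 * (m - a)) +
    (rnorm w1 * (m + b) + rnorm w3 * (m - b)).
  have -> : m *+ 4 * m = rnorm ((m *+ 4)%:C *: x).
    rewrite rnormZ ger0_norm//= ler0c mulrn_wge0 ?Re_norm_ge0//.
  rewrite wE -fa -fb -fa' -fb' -!rnormZ.
  by rewrite (le_trans (rnormD _ _))// lerD// rnormD.
have := sqr_rnorm (m - a) b; have := sqr_rnorm (m - b) (- a).
have := sqr_rnorm (m + a) (- b); have := sqr_rnorm (m + b) a.
rewrite -/w0 -/w1 -/w2 -/w3.
move: (rnorm w0) (rnorm w1) (rnorm w2) (rnorm w3) => n0 n1 n2 n3 e3 e2 e1 e0 le_sum.
pose N := a ^+ 2 + b ^+ 2.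
have sq_sum : (m *+ 4 * m) ^+ 2 <= 4 * ((n0 * (m + a)) ^+ 2 +
    (n2 * (m - a)) ^+ 2 + (n1 * (m + b)) ^+ 2 + (n3 * (m - b)) ^+ 2).
  have m0 : 0 <= m by exact: Re_norm_ge0.
  have {}le_sum : (m *+ 4 * m) ^+ 2 <= ((n0 * (m + a) + n2 * (m - a)) +
      (n1 * (m + b) + n3 * (m - b))) ^+ 2.
    by rewrite lerXn2r ?nnegrE ?(le_trans _ le_sum)// mulr_ge0// mulrn_wge0.
  apply: le_trans le_sum _.
  move: (n0 * _) (n1 * _) (n2 * _) (n3 * _) => t0 t1 t2 t3; rewrite -subr_ge0.
  have -> : 4 * (t0 ^+ 2 + t2 ^+ 2 + t1 ^+ 2 + t3 ^+ 2)
      - (t0 + t2 + (t1 + t3)) ^+ 2 = (t0 - t1) ^+ 2 + (t0 - t2) ^+ 2 +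
      (t0 - t3) ^+ 2 + (t1 - t2) ^+ 2 + (t1 - t3) ^+ 2 + (t2 - t3) ^+ 2 by ring.
  by rewrite !addr_ge0// sqr_ge0.
(* The difference of the two sides of [sq_sum] is [8 (N ^ 2 - N m ^ 2)]. *)
have N_le : N * m ^+ 2 <= N ^+ 2.
  by move: sq_sum; rewrite !exprMn e0 e1 e2 e3 /N; lra.
have N_small : N < m ^+ 2 by rewrite /N; nra.
have N0 : 0 <= N by rewrite addr_ge0 ?sqr_ge0.
have : N = 0.
  by apply/eqP; rewrite eq_le N0 andbT leNgt; apply/negP => Ngt0; nra.
move/eqP; rewrite paddr_eq0 ?sqr_ge0// sqrf_eq0 => /andP[/eqP -> _].
by rewrite addr0.
Qed.

(** Once [u] is scaled down to the range where [balanced_rnorm_eq] applies, all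
the points [x + l u] have norm [|x|], which extremality of [x] forbids unless
[u = 0]. *)
Lemma extreme_ball_balanced x u :
  complex_extreme (scale_set `|x| (closed_unit_ball Z)) x ->
  (forall l : R[i], `|l| <= 1 ->
     rnorm (x + l *: u) + rnorm (x - l *: u) = rnorm x *+ 2) ->
  u = 0.
Proof.
rewrite scale_closed_unit_ball// => -[_ ext] bal.
have [x0|x_neq0] := eqVneq x 0.
  have := bal 1; rewrite normr1 lexx => /(_ isT).
  rewrite scale1r x0 add0r sub0r normrN normr0 mul0rn -mulr2n => /eqP.
  by rewrite mulrn_eq0/= => /eqP u0; apply/normr0_eq0; rewrite -RRe_norm u0.
have m0 : 0 < rnorm x by rewrite -ltcR RRe_norm normr_gt0.
have u0 := Re_norm_ge0 u.
pose e := rnorm x / (2 * (rnorm x + rnorm u)).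
have den0 : 0 < 2 * (rnorm x + rnorm u) by rewrite mulr_gt0 ?ltr_pwDl.
have e0 : 0 < e by rewrite divr_gt0.
have e1 : e <= 1 by rewrite ler_pdivrMr// mul1r; lra.
have eu : e * rnorm u < rnorm x / 2.
  rewrite /e mulrAC ltr_pdivrMr//; nra.
have eN : `|e%:C| = e%:C by rewrite ger0_norm// ler0c ltW.
suff /eqP : e%:C *: u = 0.
  by rewrite scaler_eq0 -[0]/(0%:C) (inj_eq (@complexI _)) gt_eqF//= => /eqP.
apply: ext => l l1 /=; rewrite -[leLHS]RRe_norm -[leRHS]RRe_norm lecR.
have eC1 : e%:C <= 1 by rewrite lecR.
have le1 (k : R[i]) : `|k| <= 1 -> `|k * e%:C| <= 1.
  by move=> k1; rewrite normrM eN mulr_ile1// ?ler0c ?(ltW e0)//.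
have i1 : `|'i%C : R[i]| = 1 by rewrite normc_def /= expr0n expr1n add0r sqrtr1.
rewrite (@balanced_rnorm_eq x (l *: (e%:C *: u)))//.
- have l1R : rnorm l <= 1 by rewrite -lecR (RRe_norm l).
  rewrite !rnormZ eN -[complex.Re e%:C]/e (le_lt_trans _ eu)//.
  by rewrite ler_piMl// (mulr_ge0 (ltW e0)).
- by rewrite scalerA; apply: bal; exact: le1.
- by rewrite !scalerA; apply: bal; rewrite le1// normrM i1 mul1r.
Qed.
End balanced.

Lemma unit_sphere_complex_extreme {R : realType} {Z : normedModType R[i]}
    (z : Z) : ~ (forall w : Z, w = 0) ->
  complex_extreme (closed_unit_ball Z) z -> `|z| = 1.
Proof.
move=> Z_neq0 [/= z1 ext]; apply/eqP; apply/contra_notT: Z_neq0 => z_neq1 w.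
have {z_neq1}z_lt1 : 0 < 1 - `|z| by rewrite subr_gt0 lt_neqAle z_neq1.
have [//|w_neq0] := eqVneq w 0.
have w_gt0 : 0 < `|w| by rewrite normr_gt0.
pose c := (1 - `|z|) / `|w|.
have c_gt0 : 0 < c by rewrite divr_gt0.
suff /eqP : c *: w = 0 by rewrite scaler_eq0 gt_eqF//= => /eqP.
apply: ext => l l1 /=; rewrite (le_trans (ler_normD _ _))// -lerBrDl.
by rewrite 2!normrZ (gtr0_norm c_gt0) divfK ?gt_eqF// ler_piMl// ltW.
Qed.

Section lp_sum_extreme.
Context {R : realType} {p : R} (p1 : 1 <= p).
Context {X Y : completeNormedModType R[i]}.
Implicit Types z w : lp_sum p1 X Y.

Lemma lp_sum_norm_le w z : (`|w| <= `|z|) =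
  (rnorm w.1 `^ p + rnorm w.2 `^ p <= rnorm z.1 `^ p + rnorm z.2 `^ p).
Proof.
rewrite !lp_sum_normE lecR.
have p0 : 0 < p by rewrite (lt_le_trans ltr01).
apply/idP/idP => le_wz.
  have := ge0_ler_powR (ltW p0) (powR_ge0 _ _) (powR_ge0 _ _) le_wz.
  by rewrite !powRV_powR ?powR2_ge0.
by rewrite ge0_ler_powR ?nnegrE ?powR2_ge0 ?invr_ge0 ?(ltW p0).
Qed.

Lemma lp_sum_norm_le2 w z : `|w.1| <= `|z.1| -> `|w.2| <= `|z.2| ->
  `|w| <= `|z|.
Proof.
have p0 : 0 <= p by rewrite (le_trans ler01).
move=> le1 le2; rewrite lp_sum_norm_le.
by rewrite lerD// ge0_ler_powR ?nnegrE ?Re_norm_ge0// -lecR !RRe_norm.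
Qed.
End lp_sum_extreme.

Theorem proposition6p1 (R : realType) (X Y : completeNormedModType R[i])
  (XY_neq0 : ~ ((forall x : X, x = 0) /\ (forall y : Y, y = 0)))
  (p : R) (p1 : 1 <= p) :
  complex_extreme (closed_unit_ball (lp_sum p1 X Y)) =
  [set z : lp_sum p1 X Y | unit_sphere (lp_sum p1 X Y) z /\
    complex_extreme (scale_set `|z.1| (closed_unit_ball X)) z.1 /\
    complex_extreme (scale_set `|z.2| (closed_unit_ball Y)) z.2].
Proof.
apply/seteqP; split => [z z_ext|z /= [z1 [x_ext y_ext]]].
  have z1 : `|z| = 1.
    apply: unit_sphere_complex_extreme z_ext => Z0; apply: XY_neq0; split => v.
      exact: (congr1 fst (Z0 (v, 0))).
    exact: (congr1 snd (Z0 (0, v))).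
  case: z_ext => _ ext; split=> //=; rewrite !scale_closed_unit_ball//.
  split; (split=> /= [//|v v_ball]).
    apply: (congr1 fst (ext (v, 0) _)) => l l1 /=.
    by rewrite -z1 lp_sum_norm_le2//= ?scaler0 ?addr0//; exact: v_ball.
  apply: (congr1 snd (ext (0, v) _)) => l l1 /=.
  by rewrite -z1 lp_sum_norm_le2//= ?scaler0 ?addr0//; exact: v_ball.
split=> [/=|v v_ball]; first by rewrite z1.
have v_le l : `|l| <= 1 ->
    rnorm (z.1 + l *: v.1) `^ p + rnorm (z.2 + l *: v.2) `^ p <=
    rnorm z.1 `^ p + rnorm z.2 `^ p.
  by move=> l1; have := v_ball l l1; rewrite /= -z1 lp_sum_norm_le.
have v_leN l : `|l| <= 1 ->
    rnorm (z.1 - l *: v.1) `^ p + rnorm (z.2 - l *: v.2) `^ p <=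
    rnorm z.1 `^ p + rnorm z.2 `^ p.
  by move=> l1; rewrite -!scaleNr v_le// normrN.
have -> : v = (v.1, v.2) by case: (v).
congr pair.
  apply: extreme_ball_balanced x_ext _ => l l1.
  apply: (@powR_mean_balanced _ p _ _ _ (rnorm z.2) (rnorm (z.2 + l *: v.2))
    (rnorm (z.2 - l *: v.2))); rewrite ?Re_norm_ge0 ?rnorm_midpoint//.
  - exact: v_le.
  - exact: v_leN.
apply: extreme_ball_balanced y_ext _ => l l1.
apply: (@powR_mean_balanced _ p _ _ _ (rnorm z.1) (rnorm (z.1 + l *: v.1))
  (rnorm (z.1 - l *: v.1))); rewrite ?Re_norm_ge0 ?rnorm_midpoint//.
- by rewrite addrC [leRHS]addrC v_le.
- by rewrite addrC [leRHS]addrC v_leN.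
Qed.
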